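(* Let $R$ be a commutative ring with identity, let $M$ be a nonzero $R$-module and let $T$ be a submodule of $M$. Then the following hold. (i) Every $T$-sa-small submodule of $M$ is a sa-small submodule of $M$. (ii) If $M$ is a faithful prime $R$-module, then $M$ is a $T$-sa-small hollow module. (iii) If $M$ is a prime module over a semisimple ring $R$ and $N$ is a sa-small submodule of $M$, then for every submodule $T$ of $M$ with $N\subsetneq T$, $N$ is a $T$-sa-small submodule of $M$.
   Context: $R$ is a commutative ring with identity $1\neq 0$ and modules are unital. For submodules $A\le B$ of a module, $A$ is small in $B$ (written $A\ll B$) if $A\subseteq B$ and for every submodule $L$ of $B$, $A+L=B$ implies $L=B$; this is applied also to ideals of $R$ regarded as $R$-modules. $\mathrm{Ann}(X)=\{r\in R: rX=0\}$ and $(T:M)=(T:_RM)=\{r\in R: rM\subseteq T\}=\mathrm{Ann}_R(M/T)$. A submodule $N$ of $M$ is sa-small (semiannihilator small) in $M$ if for every submodule $L$ of $M$, $N+L=M$ implies $\mathrm{Ann}(L)\ll R$. For a submodule $T$ of $M$, a submodule $N$ of $M$ is $T$-sa-small in $M$ if for every nonzero submodule $X$ of $M$, $T\subseteq N+X$ implies $\mathrm{Ann}(X)\ll (T:_RM)$. $M$ is a $T$-sa-small hollow module if every submodule $N$ of $M$ is a $T$-sa-small submodule of $M$. $M$ is prime if $\mathrm{Ann}(K)=\mathrm{Ann}(M)$ for every nonzero submodule $K$ of $M$. $M$ is faithful if $\mathrm{Ann}(M)=0$.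
   Formalization: In (i) the submodule N is assumed proper (N ≠ M): M is never sa-small in itself (take L = 0, Ann(0) = R), while M is T-sa-small in itself when M is faithful and prime, e.g. R = M = Q, T = 0. *)

(* Defs.v *)
From HB Require Import structures.
From mathcomp Require Import all_boot all_order all_algebra.
From mathcomp Require Import boolp classical_sets.

Set Implicit Arguments.
Unset Strict Implicit.
Unset Printing Implicit Defensive.

Import GRing.Theory.

Local Open Scope ring_scope.
Local Open Scope classical_set_scope.

(* Submodules are arbitrary subsets [A : set V] satisfying [submodule A].
   Membership [x \in A] in a [set] is classical, so no decidability is
   imposed on them. Ideals of [R] are the submodules of [R^o]. *)

Section Submodules.
Variables (R : comNzRingType) (V : lmodType R).
Implicit Types A B L : set V.

Definition submodule A : Prop := submod_closed (mem A).

Definition sum_submod A B : set V := [set a + b | a in A & b in B].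

Definition small A B : Prop :=
  A `<=` B /\
  forall L, submodule L -> L `<=` B -> sum_submod A L = B -> L = B.

Definition semisimple_module : Prop :=
  forall A, submodule A ->
  exists B, [/\ submodule B, sum_submod A B = setT & A `&` B = [set 0]].

End Submodules.

Definition semisimple_ring (R : comNzRingType) : Prop := semisimple_module R^o.

Section AnnihilatorSmall.
Variables (R : comNzRingType) (M : lmodType R).
Implicit Types K L N T X : set M.

Definition Ann X : set R^o := [set r : R^o | forall x, X x -> r *: x = 0].

Definition colon T : set R^o := [set r : R^o | forall m : M, T (r *: m)].

Definition sa_small N : Prop :=
  forall L, submodule L -> sum_submod N L = setT -> small (Ann L) setT.

Definition T_sa_small T N : Prop :=
  forall X, submodule X -> X <> [set 0] ->
    T `<=` sum_submod N X -> small (Ann X) (colon T).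

Definition T_sa_small_hollow T : Prop :=
  forall N, submodule N -> T_sa_small T N.

Definition prime_module : Prop :=
  forall K, submodule K -> K <> [set 0] -> Ann K = Ann setT.

Definition faithful_module : Prop := Ann setT = [set 0].

End AnnihilatorSmall.

Arguments semisimple_module {R} V.
Arguments prime_module {R} M.
Arguments faithful_module {R} M.

(* Main.v *)
Require Import Defs.
From HB Require Import structures.
From mathcomp Require Import all_boot all_order all_algebra.
From mathcomp Require Import boolp classical_sets.

Import GRing.Theory.

Local Open Scope ring_scope.
Local Open Scope classical_set_scope.

(** Each clause reduces to one fact about smallness of ideals.

    - Smallness is inherited upwards along submodules: if [A] is small in [B]
      and [B] is a submodule, the modular law makes [A] small in the whole
      module ([small_setT]). If [N] is proper and [N + L] is everything, then
      [L] is nonzero, and [T] lies in [N + L] for any [T]; so [Ann L] is small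
      in [(T : M)], hence in the ring.
    - The zero submodule is small in every submodule ([small_zero]). In a
      faithful prime module all nonzero submodules have zero annihilator.
    - A small submodule of a semisimple module is zero, since its complement
      must be everything ([semisimple_small_eq0]). If [N] is sa-small, then
      [N + M = M] makes [Ann M] small, so over a semisimple ring [M] is
      faithful, and the previous case applies. *)

Section SmallSubmodules.
Context {R : comNzRingType} {V : lmodType R}.
Implicit Types A B L : set V.

Lemma submoduleP A :
  submodule A <-> A 0 /\ forall a u v, A u -> A v -> A (a *: u + v).
Proof.
split=> [[A0 AZD]|[A0 AZD]]; split; rewrite ?inE //.
- by move: A0; rewrite inE.
- by move=> a u v Au Av; have := AZD a u v; rewrite !inE; exact.
- by move=> a u v; rewrite !inE; exact: AZD.
Qed.

Lemma submodule0 A : submodule A -> A 0.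
Proof. by case/submoduleP. Qed.

Lemma submoduleD A u v : submodule A -> A u -> A v -> A (u + v).
Proof. by case/submoduleP=> _ AZD Au Av; rewrite -[u]scale1r; apply: AZD. Qed.

Lemma submoduleZ A a u : submodule A -> A u -> A (a *: u).
Proof. by case/submoduleP=> A0 AZD Au; rewrite -[_ *: _]addr0; apply: AZD. Qed.

Lemma submoduleB A u v : submodule A -> A u -> A v -> A (u - v).
Proof.
move=> sA Au Av; apply: submoduleD => //.
by rewrite -scaleN1r; apply: submoduleZ.
Qed.

Lemma submodule_setT : submodule (setT : set V).
Proof. by apply/submoduleP. Qed.

Lemma submoduleI A B : submodule A -> submodule B -> submodule (A `&` B).
Proof.
move=> /submoduleP[A0 AZD] /submoduleP[B0 BZD]; apply/submoduleP.
by split=> // a u v [Au Bu] [Av Bv]; split; [apply: AZD | apply: BZD].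
Qed.

Lemma sum_submod0l A : sum_submod [set 0] A = A.
Proof.
apply/seteqP; split=> [x [_ -> [b Ab <-]]|x Ax]; first by rewrite add0r.
by exists 0 => //; exists x; rewrite ?add0r.
Qed.

Lemma sum_submod_setT A : submodule A -> sum_submod A setT = setT.
Proof.
move=> sA; apply/seteqP; split=> // x _.
by exists 0; [exact: submodule0 | exists x; rewrite ?add0r].
Qed.

Lemma modular_law A B L : submodule B -> A `<=` B ->
  sum_submod A L = setT -> sum_submod A (L `&` B) = B.
Proof.
move=> sB AB AL; apply/seteqP; split=> [_ [a Aa [b [_ Bb] <-]]|x Bx].
  by apply: submoduleD => //; apply: AB.
have [a Aa [l Ll alx]] : sum_submod A L x by rewrite AL.
exists a => //; exists l => //; split=> //.
by rewrite -(addKr a l) addrC alx; apply: submoduleB => //; apply: AB.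
Qed.

(** If [A + L] is everything, the modular law gives [A + (L & B) = B], so
    smallness in [B] forces [B], and with it [A], into [L]. *)
Lemma small_setT A B : submodule B -> small A B -> small A setT.
Proof.
move=> sB [AB smallA]; split=> // L sL _ AL.
have LB : L `&` B = B.
  by apply: smallA; [exact: submoduleI | exact: subIsetr | exact: modular_law].
apply/seteqP; split=> // x _; have : sum_submod A L x by rewrite AL.
case=> a /AB Ba [l Ll <-]; apply: submoduleD => //.
by move: Ba; rewrite -LB => -[].
Qed.

Lemma small_zero B : submodule B -> small [set 0] B.
Proof.
move=> sB; split=> [_ ->|L _ _]; first exact: submodule0.
by rewrite sum_submod0l.
Qed.

(** A complement [B] of [A] has [A + B] everything, so smallness makes [B]
    everything, and then [A & B = 0] reads [A = 0]. *)
Lemma semisimple_small_eq0 A :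
  semisimple_module V -> submodule A -> small A setT -> A = [set 0].
Proof.
move=> ssV sA [_ smallA]; have [B [sB AB AIB0]] := ssV A sA.
by rewrite -AIB0 (smallA B) ?setIT.
Qed.

End SmallSubmodules.

Section Annihilators.
Context {R : comNzRingType} {M : lmodType R}.
Implicit Types L N T X : set M.

Lemma submodule_Ann X : submodule (Ann X).
Proof.
apply/submoduleP; split=> [x _|a r s rX sX x Xx]; first by rewrite scale0r.
by rewrite scalerDl -scalerA rX // sX // scaler0 addr0.
Qed.

Lemma submodule_colon T : submodule T -> submodule (colon T).
Proof.
move=> sT; apply/submoduleP; split=> [m|a r s rT sT' m].
  by rewrite scale0r; apply: submodule0.
rewrite scalerDl -scalerA; apply: submoduleD => //.
by apply: submoduleZ.
Qed.

Lemma T_sa_small_sa_small T N : submodule T -> N <> setT ->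
  T_sa_small T N -> sa_small N.
Proof.
move=> sT NnT smallN L sL NL.
apply: (small_setT _ _ (submodule_colon _ sT)); apply: smallN => //; last first.
  by rewrite NL.
(* [L = 0] would give [N = N + L = M], against properness. *)
move=> L0; apply: NnT; apply/seteqP; split=> // x _.
have : sum_submod N L x by rewrite NL.
by rewrite L0 => -[a Na [_ -> <-]]; rewrite addr0.
Qed.

Lemma faithful_prime_hollow T : submodule T ->
  faithful_module M -> prime_module M -> T_sa_small_hollow T.
Proof.
move=> sT faithM primeM N _ X sX X0 _; rewrite primeM // faithM.
exact/small_zero/submodule_colon.
Qed.

(** The supplement [L := M] in the definition of sa-smallness is always
    available, and it says that [Ann M] is small in [R]. *)
Lemma sa_small_faithful N : semisimple_ring R -> submodule N ->
  sa_small N -> faithful_module M.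
Proof.
move=> ssR sN smallN; apply: semisimple_small_eq0 => //.
  exact: submodule_Ann.
by apply: smallN; [exact: submodule_setT | exact: sum_submod_setT].
Qed.

End Annihilators.

(* In the first clause [N] is taken proper: for [N = setT] the choice [L = 0]
   gives [Ann L = R], so [setT] is never sa-small, although it is T-sa-small
   in every faithful prime module. *)
Theorem theorem3p3 (R : comNzRingType) (M : lmodType R) (T : set M)
    (M_neq0 : exists m : M, m <> 0) (T_sub : submodule T) :
  [/\ (forall N : set M, submodule N -> N <> setT ->
         T_sa_small T N -> sa_small N),
      (faithful_module M -> prime_module M -> T_sa_small_hollow T)
    & (prime_module M -> semisimple_ring R ->
       forall N : set M, submodule N -> sa_small N ->
       forall T' : set M, submodule T' -> N `<` T' -> T_sa_small T' N)].
Proof.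
split.
- by move=> N _; apply: T_sa_small_sa_small.
- exact: faithful_prime_hollow.
- move=> primeM ssR N sN smallN T' sT' _.
  apply: faithful_prime_hollow => //.
  exact: sa_small_faithful smallN.
Qed.
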